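(* Let $d\in\mathbb{N}^*$, $\mathbf{T}=(T_1,\dots,T_d)\in\mathcal{B}(\mathcal{H})^d$ and $q\in(0,1)$. Then $$\frac{q}{2\sqrt{d}\,(2-q^2)}\,\|\mathbf{T}\|\le Jt\omega_q(\mathbf{T})\le\|\mathbf{T}\|.$$
   Context: $\mathbb{N}^*$ is the set of positive integers. $\mathcal{H}$ is a complex Hilbert space with $\dim\mathcal{H}\ge 2$ and $\mathcal{B}(\mathcal{H})$ is the algebra of bounded linear operators on $\mathcal{H}$. Put $\mathbb{S}_q(\mathcal{H})=\{(x,y)\in\mathcal{H}\times\mathcal{H}: \|x\|=\|y\|=1,\ \langle x,y\rangle=q\}$. The joint $q$-numerical radius is $Jt\omega_q(\mathbf{T})=\sup\{(\sum_{i=1}^d|\langle T_ix,y\rangle|^2)^{1/2} : (x,y)\in\mathbb{S}_q(\mathcal{H})\}$, and the norm of the tuple is $\|\mathbf{T}\|=\sup\{(\sum_{i=1}^d\|T_ix\|^2)^{1/2} : x\in\mathcal{H},\ \|x\|=1\}$. *)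

(* Defs.v *)
From mathcomp Require Export all_boot all_order all_algebra.
From mathcomp Require Export sesquilinear complex.
From mathcomp Require Export classical_sets reals topology normedtype.

Set Implicit Arguments.
Unset Strict Implicit.
Unset Printing Implicit Defensive.

Import Order.TTheory GRing.Theory Num.Theory.
Import numFieldNormedType.Exports.

Local Open Scope classical_set_scope.
Local Open Scope ring_scope.
Local Open Scope complex_scope.

(* A Hilbert space is a complete normed module over R[i] with a positive
   definite Hermitian form (linear in its first argument, conjugate-linear in
   the second) that induces the norm. *)
Definition induces_norm (R : realType) (H : normedModType R[i])
    (dot : {dot H for Num.conj}) : Prop :=
  forall x : H, dot x x = `|x| ^+ 2.

Definition dim_ge2 (R : realType) (H : lmodType R[i]) : Prop :=
  exists x y : H, forall a b : R[i], a *: x + b *: y = 0 -> a = 0 /\ b = 0.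

Definition bounded_op (R : realType) (H : normedModType R[i])
    (T : {linear H -> H}) : Prop :=
  exists M : R, forall x : H, `|T x| <= M%:C * `|x|.

(* Norms over R[i] are R[i]-valued; [rnorm] is the same number as an element
   of R, where suprema live. *)
Definition rnorm (R : realType) (V : normedZmodType R[i]) (x : V) : R :=
  complex.Re `|x|.

Lemma rnormE (R : realType) (V : normedZmodType R[i]) (x : V) :
  (rnorm x)%:C = `|x|.
Proof. exact/RRe_real/normr_real. Qed.

Definition Sq (R : realType) (H : normedModType R[i])
    (dot : {dot H for Num.conj}) (q : R) : set (H * H) :=
  [set p | [/\ `|p.1| = 1, `|p.2| = 1 & dot p.1 p.2 = q%:C]].

(* The two suprema below are taken with [sup], whose value is 0 on a set that
   is empty or unbounded above; for bounded operators, dim H >= 2 and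
   0 < q < 1, both sets are nonempty and bounded. *)
Definition Jtomega (R : realType) (H : normedModType R[i])
    (dot : {dot H for Num.conj}) (q : R) (d : nat)
    (T : 'I_d -> {linear H -> H}) : R :=
  sup [set Num.sqrt (\sum_(i < d) rnorm (dot (T i p.1) p.2) ^+ 2)
      | p in Sq dot q].

Definition tuple_norm (R : realType) (H : normedModType R[i]) (d : nat)
    (T : 'I_d -> {linear H -> H}) : R :=
  sup [set Num.sqrt (\sum_(i < d) rnorm (T i x) ^+ 2)
      | x in [set x : H | `|x| = 1]].

(* Main.v *)
Require Import Defs.
From mathcomp Require Import boolp ring.
Import Order.TTheory GRing.Theory Num.Theory.
Import numFieldNormedType.Exports.
Local Open Scope ring_scope.
Local Open Scope complex_scope.

(** The upper bound is Cauchy-Schwarz, applied to each [<T_i x, y>] with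
    [|y| = 1].

    The lower bound goes through the numerical radius of each [T_i].  Write [w]
    for the joint q-numerical radius.  Given a unit vector [x], take a vector
    [z] orthogonal to [x] with [|z|^2 = 1 - q^2].  Both [q x + z] and [q x - z]
    are unit vectors whose inner product with [x] is [q], so [<T_i x, q x + z>]
    and [<T_i x, q x - z>] have modulus at most [w].  Their sum is
    [2 q <T_i x, x>], hence [|<T_i x, x>| <= w / q] ([numerical_radius_le_q]).
    Polarization turns a bound on the quadratic form of an operator into twice
    that bound on its norm ([numerical_radius_bound]), so [|T_i x| <= 2 w / q]
    ([op_norm_le_q]).  Summing the [d] squares gives
    [|T| <= 2 (sqrt d) w / q] ([tuple_norm_le_Jtomega]).  This is the lower
    bound with the factor [2 - q^2] replaced by [1], and [1 <= 2 - q^2]. *)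

Set Implicit Arguments.
Unset Strict Implicit.

(** * Positive definite Hermitian forms *)

Section Dot.
Context {C : numClosedFieldType} {U : lmodType C} (dot : {dot U for Num.conj}).

Lemma dotC u v : dot u v = (dot v u)^*%R.
Proof. by rewrite hermC expr0 mul1r. Qed.

Lemma dotZl a u v : dot (a *: u) v = a * dot u v.
Proof. exact: linearZl_LR. Qed.

Lemma dotZr a u v : dot u (a *: v) = a^*%R * dot u v.
Proof. exact: linearZr_LR. Qed.

Lemma dotBl u v w : dot (u - v) w = dot u w - dot v w.
Proof. exact: linearBl. Qed.

Lemma dotDl u v w : dot (u + v) w = dot u w + dot v w.
Proof. exact: linearDl. Qed.

Lemma dotBr u v w : dot u (v - w) = dot u v - dot u w.
Proof. exact: linearBr. Qed.

Lemma dotDr u v w : dot u (v + w) = dot u v + dot u w.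
Proof. exact: linearDr. Qed.

Definition dotE := (dotBl, dotDl, dotBr, dotDr, dotZl, dotZr).

(** The square norm of [<v,v> u - <u,v> v], which is [<v,v>] times the component
    of [u] orthogonal to [v], is [<v,v>] times the difference of the two
    sides. *)
Lemma dot_cauchy_schwarz u v : `|dot u v| ^+ 2 <= dot u u * dot v v.
Proof.
have [->|v0] := eqVneq v 0; first by rewrite !linear0r normr0 expr0n mulr0.
have vv : 0 < dot v v by rewrite dnorm_gt0.
have := dnorm_ge0 dot (dot v v *: u - dot u v *: v).
rewrite !dotE -!dotC.
rewrite [X in 0 <= X](_ : _ = dot v v * (dot u u * dot v v - `|dot u v| ^+ 2)).
  by rewrite pmulr_rge0 // subr_ge0.
by rewrite normCK -dotC; ring.
Qed.

Definition has_free_pair := exists x y : U,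
  forall a b : C, a *: x + b *: y = 0 -> a = 0 /\ b = 0.

(** For a free pair [x, y], either [x] itself is orthogonal to [u], or the
    combination of [x] and [y] that cancels the inner product with [u] has a
    nonzero coefficient. *)
Lemma exists_orthogonal (free2 : has_free_pair) u :
  exists2 z, z != 0 & dot u z = 0.
Proof.
have [x [y xy]] := free2.
have [xu|xu] := eqVneq (dot x u) 0.
  exists x; last by rewrite dotC xu conjC0.
  apply/eqP => x0; have [] := xy 1 0; first by rewrite x0 scaler0 scale0r addr0.
  by move=> /eqP; rewrite oner_eq0.
exists (dot y u *: x - dot x u *: y).
  apply: contra_neqN xu => /eqP h.
  have [] := xy (dot y u) (- dot x u); first by rewrite scaleNr.
  by move=> _ /eqP; rewrite oppr_eq0 => /eqP.
by rewrite dotC !dotE mulrC subrr conjC0.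
Qed.

(** * From the numerical radius to the norm *)

Lemma polarization (T : {linear U -> U}) x y :
  4 * dot (T x) y =
    dot (T (x + y)) (x + y) - dot (T (x - y)) (x - y)
  + 'i%R * dot (T (x + 'i%R *: y)) (x + 'i%R *: y)
  - 'i%R * dot (T (x - 'i%R *: y)) (x - 'i%R *: y).
Proof.
rewrite !(linearB T) !(linearD T) !(linearZ_LR T) /= !dotE !conjCi.
have : ('i%R : C) * 'i%R = -1 by rewrite -expr2 sqrCi.
set j := 'i%R => h.
by ring: h.
Qed.

(** Each of the four terms of the polarization identity is bounded by [w] times
    the square norm of its argument; by the parallelogram law these square norms
    add up to [4 (<x,x> + <y,y>)]. *)
Lemma numerical_radius_bound (T : {linear U -> U}) (w : C) :
  (forall x, `|dot (T x) x| <= w * dot x x) ->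
  forall x y, `|dot (T x) y| <= w * (dot x x + dot y y).
Proof.
move=> hw x y.
have tri (a b c e : C) : `|a - b + c - e| <= `|a| + `|b| + `|c| + `|e|.
  apply: le_trans (ler_normB _ _) _; rewrite lerD2r.
  by apply: le_trans (ler_normD _ _) _; rewrite lerD2r ler_normB.
rewrite -(ler_pM2l (_ : 0 < 4)) // -[X in X * _]ger0_norm // -normrM polarization.
set i := 'i%R.
have i1 : `|i| = 1 by exact: normCi.
apply: le_trans (tri _ _ _ _) _; rewrite !normrM i1 !mul1r.
apply: le_trans (lerD (lerD (lerD (hw _) (hw _)) (hw _)) (hw _)) _.
rewrite !dnormB !dnormD !dnormZ i1 /= le_eqVlt; apply/orP; left; apply/eqP.
by ring.
Qed.

(** * From the q-numerical radius to the numerical radius *)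

(** The two vectors are [q u + s z] and [q u - s z], with [z] orthogonal to [u]
    and [s] chosen so that [|s z|^2 = 1 - q^2]. *)
Lemma exists_q_companions (free2 : has_free_pair) (q : C) u :
    0 <= q -> q <= 1 -> dot u u = 1 ->
  exists v w, [/\ dot v v = 1, dot w w = 1, dot u v = q, dot u w = q
                & v + w = (q *+ 2) *: u].
Proof.
move=> q0 q1 uu.
have [z z0 uz] := exists_orthogonal free2 u.
have zz : 0 < dot z z by rewrite dnorm_gt0.
have qc : q^*%R = q by rewrite geC0_conj.
pose s := sqrtC ((1 - q ^+ 2) / dot z z).
have s0 : 0 <= s.
  by rewrite sqrtC_ge0 divr_ge0 ?subr_ge0 ?expr_le1 // ltW.
have sc : s^*%R = s by rewrite geC0_conj.
have ss : s * s * dot z z = 1 - q ^+ 2 by rewrite -expr2 sqrtCK divfK ?gt_eqF.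
have zu : dot z u = 0 by rewrite dotC uz conjC0.
exists (q *: u + s *: z), (q *: u - s *: z); split.
- by rewrite !dotE qc sc uu uz zu; ring: ss.
- by rewrite !dotE qc sc uu uz zu; ring: ss.
- by rewrite !dotE qc sc uu uz; ring.
- by rewrite !dotE qc sc uu uz; ring.
- by rewrite addrACA subrr addr0 -scalerDl.
Qed.

(** Averaging over the two companions of a unit vector [v] isolates
    [q <T v, v>]. *)
Lemma numerical_radius_le_q (free2 : has_free_pair) (T : {linear U -> U})
    (q w : C) :
    0 < q -> q <= 1 ->
    (forall u v, dot u u = 1 -> dot v v = 1 -> dot u v = q ->
       `|dot (T u) v| <= w) ->
  forall u, `|dot (T u) u| <= w / q * dot u u.
Proof.
move=> q0 q1 hw u.
have qw v : dot v v = 1 -> `|dot (T v) v| <= w / q.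
  move=> vv.
  have [y [z [yy zz vy vz yz]]] := exists_q_companions free2 (ltW q0) q1 vv.
  rewrite ler_pdivlMr // -(ler_pM2r (_ : 0 < 2)) //.
  have <- : `|dot (T v) (y + z)| = `|dot (T v) v| * q * 2.
    by rewrite yz dotZr normrM norm_conjC normrMn (gtr0_norm q0); ring.
  by rewrite dotDr (le_trans (ler_normD _ _)) // mulr_natr mulr2n lerD // hw.
have [->|u0] := eqVneq u 0; first by rewrite linear0 !linear0r normr0 mulr0.
have uu : 0 < dot u u by rewrite dnorm_gt0.
pose s := (sqrtC (dot u u))^-1.
have sc : s^*%R = s by rewrite geC0_conj // invr_ge0 sqrtC_ge0 ltW.
have ss : s * s * dot u u = 1 by rewrite -expr2 exprVn sqrtCK mulVf ?gt_eqF.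
have := qw (s *: u); rewrite (linearZ_LR T) /= !dotE sc !mulrA ss => /(_ erefl).
rewrite -(ler_pM2r uu); apply: le_trans.
rewrite -[X in _ * X](gtr0_norm uu) -normrM -[X in `|X| <= _]mul1r -ss.
by rewrite [leRHS](_ : _ = `|s * s * dot u u * dot (T u) u|) //; congr `|_|; ring.
Qed.

(** The bound on [<T u, y>] is used at the unit vector [y] in the direction of
    [T u]. *)
Lemma op_norm_le_q (free2 : has_free_pair) (T : {linear U -> U}) (q w : C) :
    0 < q -> q <= 1 ->
    (forall u v, dot u u = 1 -> dot v v = 1 -> dot u v = q ->
       `|dot (T u) v| <= w) ->
  forall u, dot u u = 1 -> sqrtC (dot (T u) (T u)) <= 2 * w / q.
Proof.
move=> q0 q1 hw u uu.
have hT := numerical_radius_bound (numerical_radius_le_q free2 q0 q1 hw).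
have [Tu0|Tu0] := eqVneq (T u) 0.
  rewrite Tu0 linear0r sqrtC0.
  have := hT u 0; rewrite !linear0r normr0 uu addr0 mulr1 -mulrA => wq.
  by rewrite pmulr_rge0.
pose n := sqrtC (dot (T u) (T u)).
have n0 : 0 < n by rewrite sqrtC_gt0 dnorm_gt0.
have nn : dot (T u) (T u) = n * n by rewrite -expr2 sqrtCK.
have nc : (n^-1)^*%R = n^-1 by rewrite geC0_conj // invr_ge0 ltW.
have := hT u (n^-1 *: T u).
rewrite !dotE nc nn uu mulKf ?gt_eqF // mulVf ?gt_eqF // gtr0_norm //.
rewrite -expr2 (sqrCK (ltW n0)).
by have -> : w / q * (1 + 1) = 2 * w / q by ring.
Qed.

End Dot.

(** * Suprema over unit vectors *)

(** The supremum of a set that is empty or unbounded above is [0]; otherwise it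
    dominates some [f x]. *)
Lemma sup_image_ge0 (R : realType) (A : Type) (S : set A) (f : A -> R) :
  (forall x, 0 <= f x) -> 0 <= sup [set f x | x in S]%classic.
Proof.
move=> f0; have [hs|/sup_out -> //] := pselect (has_sup [set f x | x in S]%classic).
have [_ [x Sx _]] := hs.1.
by apply: le_trans (f0 x) _; apply: sup_upper_bound => //; exists x.
Qed.

Lemma rnorm_ge0 (R : realType) (V : normedZmodType R[i]) (x : V) : 0 <= rnorm x.
Proof. by rewrite -ler0c rnormE. Qed.

Section Bounds.
Context {R : realType} {H : completeNormedModType R[i]}.
Variables (dot : {dot H for Num.conj}) (hdot : induces_norm dot).
Variable hdim : dim_ge2 H.

Lemma norm_dot_le x y : `|dot x y| <= `|x| * `|y|.
Proof.
rewrite -(ler_pXn2r (ltn0Sn 1)) ?nnegrE ?mulr_ge0 // exprMn -!hdot.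
exact: dot_cauchy_schwarz.
Qed.

Lemma unitE x : `|x| = 1 <-> dot x x = 1.
Proof.
rewrite hdot; split=> [->|/eqP]; first by rewrite expr1n.
rewrite sqrf_eq1 => /orP[/eqP//|/eqP h].
by have := normr_ge0 x; rewrite h oppr_ge0 ler10.
Qed.

Lemma rnorm_le_q (T : {linear H -> H}) (q w : R) :
    0 < q -> q <= 1 ->
    (forall p, Sq dot q p -> rnorm (dot (T p.1) p.2) <= w) ->
  forall x, `|x| = 1 -> rnorm (T x) <= 2 * w / q.
Proof.
move=> q0 q1 hw x /unitE xx.
rewrite -lecR rnormE.
have -> : `|T x| = sqrtC (dot (T x) (T x)) by rewrite hdot sqrCK.
have -> : (2 * w / q)%:C = 2 * w%:C / q%:C.
  by rewrite !rmorphM /= fmorphV rmorph_nat.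
apply: op_norm_le_q => //; rewrite ?ltcR ?lecR //.
move=> u v /unitE u1 /unitE v1 uv; rewrite -rnormE lecR.
exact: (hw (u, v)).
Qed.

Lemma exists_unit : exists x : H, `|x| = 1.
Proof.
have [z z0 _] := exists_orthogonal dot hdim 0.
exists (`|z|^-1 *: z); rewrite normrZ ger0_norm ?invr_ge0 //.
by rewrite mulVf // normr_eq0.
Qed.

Lemma Sq_nonempty (q : R) : 0 <= q -> q <= 1 -> (Sq dot q !=set0)%classic.
Proof.
move=> q0 q1; have [x x1] := exists_unit.
have [||v [_ [v1 _ xv _ _]]] :=
  @exists_q_companions _ _ dot hdim q%:C x _ _ ((unitE x).1 x1); rewrite ?lecR //.
by exists (x, v); split=> //=; apply/unitE.
Qed.

Section Tuple.
Variables (d : nat) (T : 'I_d -> {linear H -> H}).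
Hypothesis hT : forall i, bounded_op (T i).

Lemma tuple_norm_has_ubound :
  has_ubound [set Num.sqrt (\sum_(i < d) rnorm (T i x) ^+ 2)
             | x in [set x : H | `|x| = 1]]%classic.
Proof.
have [M hM] := choice hT.
exists (Num.sqrt (\sum_(i < d) M i ^+ 2)) => _ [x x1 <-].
rewrite ler_wsqrtr // ler_sum // => i _.
have TM : rnorm (T i x) <= M i.
  by rewrite -lecR rnormE; have := hM i x; rewrite x1 mulr1.
by rewrite ler_pXn2r // nnegrE ?(le_trans _ TM) ?rnorm_ge0.
Qed.

Lemma sqrt_sum_dot_le (q : R) p :
  Sq dot q p ->
  Num.sqrt (\sum_(i < d) rnorm (dot (T i p.1) p.2) ^+ 2) <=
  Num.sqrt (\sum_(i < d) rnorm (T i p.1) ^+ 2).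
Proof.
case=> _ p2 _; rewrite ler_wsqrtr // ler_sum // => i _.
rewrite ler_pXn2r ?nnegrE ?rnorm_ge0 // -lecR !rnormE.
by rewrite (le_trans (norm_dot_le _ _)) // p2 mulr1.
Qed.

Lemma Jtomega_has_ubound (q : R) :
  has_ubound [set Num.sqrt (\sum_(i < d) rnorm (dot (T i p.1) p.2) ^+ 2)
             | p in Sq dot q]%classic.
Proof.
have [M hM] := tuple_norm_has_ubound; exists M => _ [p pS <-].
apply: le_trans (sqrt_sum_dot_le pS) _; apply: hM; exists p.1 => //.
by case: pS.
Qed.

Lemma Jtomega_ge0 (q : R) : 0 <= Jtomega dot q T.
Proof. by apply: sup_image_ge0 => p; exact: sqrtr_ge0. Qed.

Lemma Jtomega_le_tuple_norm (q : R) :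
  0 <= q -> q <= 1 -> Jtomega dot q T <= tuple_norm T.
Proof.
move=> q0 q1; apply: ge_sup; first exact/image_nonempty/Sq_nonempty.
move=> _ [p pS <-]; apply: le_trans (sqrt_sum_dot_le pS) _.
apply: ub_le_sup; first exact: tuple_norm_has_ubound.
by exists p.1 => //; case: pS.
Qed.

(** The joint radius dominates the q-numerical radius of every [T i], so each
    [T i] is bounded by [2 w / q] on unit vectors; the [sqrt d] is the cost of
    bounding the [d] components separately. *)
Lemma tuple_norm_le_Jtomega (q : R) :
    0 < q -> q <= 1 ->
  tuple_norm T <= 2 * Num.sqrt d%:R / q * Jtomega dot q T.
Proof.
move=> q0 q1; set w := Jtomega dot q T.
have hw i p : Sq dot q p -> rnorm (dot (T i p.1) p.2) <= w.
  move=> pS.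
  have : Num.sqrt (\sum_(i < d) rnorm (dot (T i p.1) p.2) ^+ 2) <= w.
    by apply: ub_le_sup; [exact: Jtomega_has_ubound | exists p].
  apply: le_trans; rewrite -[leLHS](ger0_norm (rnorm_ge0 _)) -sqrtr_sqr.
  rewrite ler_wsqrtr // (bigD1 i) //= lerDl sumr_ge0 // => j _.
  exact: sqr_ge0.
apply: ge_sup; first by apply: image_nonempty; exact: exists_unit.
move=> _ [x x1 <-].
have b0 : 0 <= 2 * w / q by rewrite divr_ge0 ?mulr_ge0 ?Jtomega_ge0 // ltW.
rewrite (_ : _ * w = Num.sqrt (\sum_(i < d) (2 * w / q) ^+ 2)).
  rewrite ler_wsqrtr // ler_sum // => i _.
  rewrite ler_pXn2r ?nnegrE ?rnorm_ge0 //.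
  exact: (rnorm_le_q q0 q1 (hw i) x1).
rewrite sumr_const card_ord -(mulr_natl (_ ^+ 2) d) sqrtrM ?ler0n //.
rewrite sqrtr_sqr ger0_norm //.
by ring.
Qed.

End Tuple.
End Bounds.

Unset Implicit Arguments.

Theorem theorem15 (R : realType) (H : completeNormedModType R[i])
    (dot : {dot H for Num.conj}) (hdot : induces_norm dot) (hdim : dim_ge2 H)
    (d : nat) (hd : (0 < d)%N)
    (T : 'I_d -> {linear H -> H}) (hT : forall i : 'I_d, bounded_op (T i))
    (q : R) (hq0 : 0 < q) (hq1 : q < 1) :
  q / (2 * Num.sqrt (d%:R) * (2 - q ^+ 2)) * tuple_norm T <= Jtomega dot q T
  /\ Jtomega dot q T <= tuple_norm T.
Proof.
split; last by apply: Jtomega_le_tuple_norm; rewrite ?ltW.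
set s := Num.sqrt d%:R.
have s0 : 0 < s by rewrite sqrtr_gt0 ltr0n.
have t1 : 1 <= 2 - q ^+ 2.
  have -> : 2 - q ^+ 2 = 1 + (1 - q ^+ 2) by ring.
  by rewrite lerDl subr_ge0 expr_le1 ?ltW.
have t0 : 0 < 2 - q ^+ 2 by apply: lt_le_trans t1.
have := tuple_norm_le_Jtomega hdot hdim hT hq0 (ltW hq1).
rewrite -/s mulrAC ler_pdivlMr // => Nw.
rewrite mulrAC ler_pdivrMr ?mulr_gt0 // mulrC; apply: le_trans Nw _.
rewrite [leRHS](_ : _ = 2 * s * Jtomega dot q T * (2 - q ^+ 2)); last by ring.
by rewrite ler_peMr ?mulr_ge0 ?(ltW s0) ?Jtomega_ge0.
Qed.
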